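(* Let $(\frac pq,\frac rs)$ be a Farey pair of order $n$ with $0<\frac pq$, $\frac rs<1$ and $q<s$. Let $d=\lfloor n/q\rfloor$ and, for $\alpha\in[0,1]$, $\beta=1-\alpha$, let $\phi_\alpha(t)=(t^q-\beta)^d-\alpha^dt^{qd-s}$. Let $\theta\in\arg(q,s)$, let $t=\rho e^{i\theta}$ be the point of $\partial\Theta_n$ with argument $\theta$, and let $\alpha(\theta)\in[0,1]$ be such that $t$ is a root of $\phi_{\alpha(\theta)}$. Then $t$ is a subdominant root of $\phi_{\alpha(\theta)}$.
   Context: A matrix is stochastic if it is entrywise nonnegative with all row sums $1$; $\Theta_n$ is the set of all eigenvalues of all $n\times n$ stochastic matrices and $\partial\Theta_n$ its boundary. $\mathcal{F}_n=\{p/q:0\le p<q\le n,\ \gcd(p,q)=1\}$; a Farey pair of order $n$ is a pair $(\frac pq,\frac rs)$ of elements of $\mathcal F_n$ with $\frac pq<\frac rs$ and no element of $\mathcal F_n$ strictly between them. $\arg(q,s)=(\frac{2\pi p}{q},\frac{2\pi r}{s})\cup(\frac{2\pi(s-r)}{s},\frac{2\pi(q-p)}{q})$, arguments in $[0,2\pi)$. The number $1$ is always a root of $\phi_\alpha$ of maximum modulus; a root $z$ of $\phi_\alpha$ is called subdominant if its modulus is the next largest after that of $1$, i.e. $|z|=\max\{|w|: w\ne 1,\ \phi_\alpha(w)=0\}$. *)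

(* Defs.v *)
From HB Require Import structures.
From mathcomp Require Import all_boot all_order all_algebra.
From mathcomp Require Import complex.
From mathcomp Require Import reals trigo.
Set Implicit Arguments. Unset Strict Implicit. Unset Printing Implicit Defensive.
Import Order.TTheory GRing.Theory Num.Theory.
Local Open Scope ring_scope.
Local Open Scope complex_scope.

Definition stochastic (R : realType) (n : nat) (A : 'M[R]_n) : Prop :=
  (forall i j, 0 <= A i j) /\ (forall i, \sum_(j < n) A i j = 1).

Definition Theta (R : realType) (n : nat) : R[i] -> Prop :=
  fun l => exists A : 'M[R]_n,
    stochastic A /\ eigenvalue (map_mx (fun x : R => x%:C) A) l.

Definition boundary (R : realType) (S : R[i] -> Prop) (t : R[i]) : Prop :=
  forall e : R, 0 < e ->
    (exists z, S z /\ `|z - t| < e%:C) /\ (exists z, ~ S z /\ `|z - t| < e%:C).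

Definition in_Farey (n a b : nat) : Prop := (a < b <= n)%N /\ coprime a b.

Definition Farey_pair (n p q r s : nat) : Prop :=
  in_Farey n p q /\ in_Farey n r s /\
  (p%:Q / q%:Q < r%:Q / s%:Q)%R /\
  (forall a b, in_Farey n a b ->
     ~ ((p%:Q / q%:Q < a%:Q / b%:Q)%R /\ (a%:Q / b%:Q < r%:Q / s%:Q)%R)).

Definition in_arg (R : realType) (p q r s : nat) (th : R) : Prop :=
  (2 * pi * p%:R / q%:R < th < 2 * pi * r%:R / s%:R) \/
  (2 * pi * (s - r)%N%:R / s%:R < th < 2 * pi * (q - p)%N%:R / q%:R).

(* phi_alpha(t) = (t^q - beta)^d - alpha^d t^(qd - s), beta = 1 - alpha,
   d = floor(n/q); the exponent qd - s is an integer (possibly negative). *)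
Definition phi (R : realType) (n q s : nat) (alpha : R) (t : R[i]) : R[i] :=
  let d := (n %/ q)%N in
  (t ^+ q - (1 - alpha)%:C) ^+ d
  - (alpha ^+ d)%:C * t ^ ((q * d)%:Z - s%:Z)%R.

Definition subdominant_root (R : realType) (n q s : nat) (alpha : R) (z : R[i]) : Prop :=
  phi n q s alpha z = 0 /\ z != 1 /\
  (forall w, phi n q s alpha w = 0 -> w != 1 -> `|w| <= `|z|).

(* Main.v *)
Require Import Defs.
From HB Require Import structures.
From mathcomp Require Import all_boot all_order all_algebra.
From mathcomp Require Import complex.
From mathcomp Require Import classical_sets filter reals topology normedtype derive.
From mathcomp Require Import realfun exp trigo.
From mathcomp Require Import ring lra zify.
Import Order.TTheory GRing.Theory Num.Theory.
Import numFieldNormedType.Exports.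
Local Open Scope ring_scope.
Local Open Scope complex_scope.
Set Implicit Arguments.
Unset Strict Implicit.

(** With [z ^ q = tau ^ (d q) e^(i x)] and [|z| = tau ^ d], the equation
    [phi z = 0] says that [alpha tau^(-s)] and [beta tau^(-d q)] are two sides
    of a triangle with base 1 and base angles [x] and [w] (opposite to them),
    together with the phase condition [s x + q d w = 0 mod 2 pi].  Along a fixed
    [alpha] the value [s x + q d w] is a monotone function of [- ln tau], because
    the logarithms of the sides, as functions of the angles, form the gradient
    of a strictly convex function.  Hence a root with [s x + q d w = 2 pi], the
    least positive value, has maximal modulus among the roots other than 1.

    A point [t] of argument in the given range has [s x + q d w = 2 pi m] with
    [m] in [1 + q N].  If [m > 1], the root with [m = 1] on the same ray is
    larger; it is an eigenvalue of an explicit stochastic matrix, and so are the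
    corresponding roots on nearby rays.  Since [Theta_n] is star-shaped, [t] would
    then be an interior point. *)

(** * Phases with cosine 1, and sine inequalities for triangles *)

Lemma cos_lt1 (R : realType) (x : R) : 0 < x < 2 * pi -> cos x < 1.
Proof.
move=> /andP[x0 x2].
have s0 : 0 < sin (x / 2) by apply: sin_gt0_pi; apply/andP; split; lra.
have -> : x = (x / 2) *+ 2 by rewrite mulr2n; lra.
by rewrite cos_mulr2n cos2sin2 mulr2n; have := mulr_gt0 s0 s0; rewrite -expr2; lra.
Qed.

(** Only the least positive multiple of [2 pi] matters for the phase, so no integer quotient is
    extracted. *)
Lemma cos_eq1_ge0 (R : realType) (x : R) :
  0 <= x -> cos x = 1 -> x = 0 \/ 2 * pi <= x.
Proof.
move=> x0 c1; have [->|xn0] := eqVneq x 0; first by left.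
right; rewrite leNgt; apply/negP => x2.
by have := @cos_lt1 R x; rewrite c1 ltxx lt_neqAle eq_sym xn0 x0 x2 => /(_ isT).
Qed.

Lemma cos_eq1_gtN2pi (R : realType) (x : R) : - (2 * pi) < x -> cos x = 1 -> 0 <= x.
Proof.
move=> x2 c1; rewrite leNgt; apply/negP => x0.
have := @cos_lt1 R (- x); rewrite cosN c1 ltxx => h.
by apply/notF/h/andP; split; lra.
Qed.

Lemma is_derive_ln_sin (R : realType) (a b u : R) : 0 < sin (a + u * b) ->
  is_derive u 1 (fun z : R => ln (sin (a + z * b)))
    (b * (cos (a + u * b) / sin (a + u * b))).
Proof.
move=> s0.
have h : is_derive u 1 (fun z : R => a + z * b) b.
  by apply: is_derive_eq; rewrite /GRing.scale /= mulr0 mulr1 !add0r mul1r.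
have h2 := @is_derive1_comp R sin (fun z : R => a + z * b) u _ _ (is_derive_sin _) h.
have h3 := @is_derive1_comp R (@ln R) (fun z : R => sin (a + z * b)) u _ _
   (is_derive1_ln s0) h2.
apply: is_derive_eq; rewrite /GRing.scale /=; ring.
Qed.

(* The left-hand side is the gradient of a strictly convex function of the
   angles of a triangle, tested against a displacement. *)
Lemma ln_sin_triangle_monotone (R : realType) (x1 y1 x2 y2 : R) :
  0 < x1 -> 0 < y1 -> x1 + y1 < pi ->
  0 < x2 -> 0 < y2 -> x2 + y2 < pi -> (x1 != x2) || (y1 != y2) ->
  0 < (x2 - x1) * ((ln (sin x2) - ln (sin (x2 + y2)))
                   - (ln (sin x1) - ln (sin (x1 + y1))))
    + (y2 - y1) * ((ln (sin y2) - ln (sin (x2 + y2)))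
                   - (ln (sin y1) - ln (sin (x1 + y1)))).
Proof.
move=> hx1 hy1 h1 hx2 hy2 h2 ne.
set dx := x2 - x1; set dy := y2 - y1.
(* [h u] is the gradient at a point of the segment joining the two angle pairs, tested against the
   displacement [(dx, dy)]. The claim is [h 0 < h 1], by the mean value theorem. *)
pose h (u : R) := dx * ln (sin (x1 + u * dx)) + dy * ln (sin (y1 + u * dy))
  - (dx + dy) * ln (sin ((x1 + y1) + u * (dx + dy))).
pose dh (u : R) := dx * (dx * (cos (x1 + u * dx) / sin (x1 + u * dx)))
  + dy * (dy * (cos (y1 + u * dy) / sin (y1 + u * dy)))
  - (dx + dy) * ((dx + dy) * (cos ((x1 + y1) + u * (dx + dy)) /
                              sin ((x1 + y1) + u * (dx + dy)))).
have pos (u : R) : 0 <= u <= 1 -> [/\ 0 < sin (x1 + u * dx), 0 < sin (y1 + u * dy)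
   & 0 < sin ((x1 + y1) + u * (dx + dy))].
  move=> /andP[u0 u1]; rewrite /dx /dy.
  have conv a b c : a < b -> a < c -> a < b + u * (c - b).
    move=> ab ac; have [u0' | u0'] := lerP u (1 / 2).
      have : 0 <= u * (c - a) by apply: mulr_ge0; lra.
      have : 0 < (1 - u) * (b - a) by apply: mulr_gt0; lra.
      by lra.
    have : 0 < u * (c - a) by apply: mulr_gt0; lra.
    have : 0 <= (1 - u) * (b - a) by apply: mulr_ge0; lra.
    by lra.
  have conv' a b c : b < a -> c < a -> b + u * (c - b) < a.
    move=> ba ca; have := conv (- a) (- b) (- c); rewrite !ltrN2 => /(_ ba ca).
    by lra.
  have X := conv 0 x1 x2 hx1 hx2; have Y := conv 0 y1 y2 hy1 hy2.
  have Z := conv' _ _ _ h1 h2.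
  by split; apply: sin_gt0_pi; apply/andP; split; lra.
have der (u : R) : 0 <= u <= 1 -> is_derive u 1 h (dh u).
  move=> /pos[p1 p2 p3].
  have d1 := is_derive_ln_sin p1; have d2 := is_derive_ln_sin p2.
  have d3 := is_derive_ln_sin p3.
  rewrite /h /dh.
  by apply: is_derive_eq; rewrite /GRing.scale /=; ring.
have [c cI e] : exists2 c, c \in `](0:R), 1[%R & h 1 - h 0 = dh c * (1 - 0).
  apply: MVT; first exact: ltr01.
    by move=> u /itvP u01; apply: der; rewrite !u01.
  apply: derivable_within_continuous => u /itvP u01.
  have [] // : is_derive u 1 h (dh u) by apply: der; rewrite !u01.
have c01 : 0 <= c <= 1 by rewrite !(itvP cI).
have [p1 p2 p3] := pos c c01.
have -> : dx * (ln (sin x2) - ln (sin (x2 + y2)) - (ln (sin x1) - ln (sin (x1 + y1)))) +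
  dy * (ln (sin y2) - ln (sin (x2 + y2)) - (ln (sin y1) - ln (sin (x1 + y1)))) = h 1 - h 0.
  rewrite /h !mul1r !mul0r !addr0.
  have -> : x1 + dx = x2 by rewrite /dx; ring.
  have -> : y1 + dy = y2 by rewrite /dy; ring.
  have -> : x1 + y1 + (dx + dy) = x2 + y2 by rewrite /dx /dy; ring.
  by ring.
rewrite e subr0 mulr1 /dh.
have eS : x1 + y1 + c * (dx + dy) = (x1 + c * dx) + (y1 + c * dy) by ring.
rewrite eS in p3 *.
move: (x1 + c * dx) (y1 + c * dy) p1 p2 p3 => X Y p1 p2; rewrite sinD cosD => p3.
have sc : 0 < cos X / sin X + cos Y / sin Y.
  have -> : cos X / sin X + cos Y / sin Y
    = (sin X * cos Y + cos X * sin Y) / (sin X * sin Y) by field; rewrite !gt_eqF.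
  by rewrite divr_gt0 ?mulr_gt0.
have -> : (cos X * cos Y - sin X * sin Y) / (sin X * cos Y + cos X * sin Y)
   = (cos X / sin X * (cos Y / sin Y) - 1) / (cos X / sin X + cos Y / sin Y).
  field; rewrite !gt_eqF // addrC (mulrC (cos Y)); exact: p3.
move: (cos X / sin X) (cos Y / sin Y) sc => c1 c2 sc.
(* In the cotangents [c1], [c2] the Hessian is a sum of two squares over [c1 + c2], which is
   positive because [sin (X + Y)] is. *)
have -> : dx * (dx * c1) + dy * (dy * c2) -
   (dx + dy) * ((dx + dy) * ((c1 * c2 - 1) / (c1 + c2))) =
   ((c1 * dx - c2 * dy) ^+ 2 + (dx + dy) ^+ 2) / (c1 + c2).
  by field; rewrite gt_eqF.
apply: divr_gt0 => //; rewrite lt_neqAle addr_ge0 ?sqr_ge0 // andbT eq_sym.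
rewrite paddr_eq0 ?sqr_ge0 // !sqrf_eq0; apply/negP => /andP[/eqP e1 /eqP e2].
have e3 : dy = - dx by lra.
have : (c1 + c2) * dx = 0 by rewrite -e1 e3; ring.
move/eqP; rewrite mulf_eq0 (gt_eqF sc) /= => /eqP dx0.
have dy0 : dy = 0 by rewrite e3 dx0 oppr0.
move: ne; rewrite /dx /dy in dx0 dy0.
by rewrite (_ : x1 = x2) 1?(_ : y1 = y2) ?eqxx //; lra.
Qed.

(* With [T = tau ^ s], [S = tau ^ (d q)] the hypothesis is
   [alpha + beta = 1] after the law of sines, so decreasing the second angle at
   fixed [x] leaves room for a larger [tau]. *)
Lemma sine_defect_lt0 (R : realType) (x y0 y T S : R) :
  0 < sin x -> 0 < y0 -> y0 < y -> y < pi -> 0 <= T -> T <= 1 ->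
  sin x * T + sin y * S = sin (x + y) ->
  sin x * T + sin y0 * S < sin (x + y0).
Proof.
move=> sx y00 y0y yp T0 T1 e.
have sy : 0 < sin y by apply: sin_gt0_pi; apply/andP; split; lra.
have sy0 : 0 < sin y0 by apply: sin_gt0_pi; apply/andP; split; lra.
have sd : 0 < sin (y - y0) by apply: sin_gt0_pi; apply/andP; split; lra.
(* Once [S] is eliminated through [e], the gap in this inequality times [sin x] is the wanted gap
   times [sin y]. *)
have key : T * (sin y - sin y0) < sin (y - y0).
  have le : sin y - sin y0 < sin (y - y0).
    have cd : cos (y - y0) < 1 by apply: cos_lt1; apply/andP; split; lra.
    have := cos_le1 y0.
    have {1}-> : y = (y - y0) + y0 by ring.
    rewrite sinD; nra.
  have [s0 | s0] := lerP (sin y - sin y0) 0; first by nra.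
  by nra.
rewrite -(ltr_pM2l sy) -subr_gt0.
suff -> : sin y * sin (x + y0) - sin y * (sin x * T + sin y0 * S)
   = sin x * (sin (y - y0) - T * (sin y - sin y0)) by rewrite mulr_gt0 // subr_gt0.
have eS : sin y * S = sin (x + y) - sin x * T by lra.
have -> : sin y * (sin x * T + sin y0 * S) = sin y * sin x * T + sin y0 * (sin y * S) by ring.
by rewrite eS !sinD !cosN !sinN; ring.
Qed.

(** * Farey neighbours *)

Lemma ltq_frac (a b c d : nat) : (0 < b)%N -> (0 < d)%N ->
  (a%:Q / b%:Q < c%:Q / d%:Q)%R = (a * d < c * b)%N.
Proof.
move=> b0 d0.
rewrite ltr_pdivrMr ?ltr0n // mulrAC ltr_pdivlMr ?ltr0n //.
by rewrite -!natrM ltr_nat.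
Qed.

(** The solutions of [p y = -1] modulo [q] form a residue class, so one lies among the [q] integers
    ending at [n]. The fraction [x / y] is the candidate for the right neighbour of [p / q]. *)
Lemma bezout_denominator (n p q : nat) : (0 < q <= n)%N -> coprime p q ->
  exists x y, (q * x = p * y + 1)%N /\ (n < y + q)%N /\ (y <= n)%N.
Proof.
move=> /andP[q0 qn] pq.
case: (egcdnP p q0) => km kn e _.
have {}e : (km * q = kn * p + 1)%N.
  by move: e; rewrite gcdnC (eqP pq).
(* This is [n - kn] modulo [q]; the term [q * kn] keeps the natural subtraction from truncating. *)
pose m := ((n + q * kn - kn) %% q)%N; have mq : (m < q)%N by rewrite ltn_pmod.
exists ((p * (n - m) + 1) %/ q)%N, (n - m)%N; split; last by lia.
rewrite mulnC divnK //.
have mn : (m <= n)%N by lia.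
have em : (n + q * kn - kn = (n + q * kn - kn) %/ q * q + m)%N by apply: divn_eq.
set c := ((n + q * kn - kn) %/ q)%N in em.
have kq : (kn <= q * kn)%N by nia.
have e2 : (n - m + q * kn = kn + c * q)%N by lia.
have e3 : (p * (n - m) + 1 + p * kn * q = (km + p * c) * q)%N.
  by nia.
by rewrite -(dvdn_addl (p * (n - m) + 1) (n := p * kn * q)) ?dvdn_mull // e3 dvdn_mull.
Qed.

(** The Bezout fraction [x / y] exceeds [p / q] by [1 / (q y)] and cannot lie strictly inside the
    pair. Beyond [r / s] it would give [1 / (q y) >= 1 / (q s) + 1 / (s y)], that is
    [s >= q + y > n]. So it equals [r / s], and both are in lowest terms. *)
Lemma Farey_pair_det (n p q r s : nat) :
  Farey_pair n p q r s -> (0 < p)%N -> (q < s)%N ->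
  (r * q = p * s + 1)%N /\ (n < q + s)%N.
Proof.
move=> [[/andP[pq qn] cpq] [[/andP[rs sn] crs] [lt none]]] p0 qs.
have q0 : (0 < q)%N by lia.
have s0 : (0 < s)%N by lia.
rewrite ltq_frac // in lt.
have [|x [y [exy [ny yn]]]] := @bezout_denominator n p q _ cpq; first by lia.
have y0 : (0 < y)%N by lia.
have xy : (x < y)%N.
  have h : (q * x + (q - p) * y = q * y + 1)%N by nia.
  by nia.
have cxy : coprime x y.
  rewrite /coprime -dvdn1 -(@dvdn_addr (p * y)) ?dvdn_mull ?dvdn_gcdr //.
  by rewrite -exy dvdn_mull ?dvdn_gcdl.
have ge : (r * y <= x * s)%N.
  rewrite leqNgt; apply/negP => h; apply: (none x y); first by rewrite /in_Farey xy yn.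
  by rewrite !ltq_frac //; split; nia.
have [e|ne] := eqVneq (r * y)%N (x * s)%N; last first.
  have gt : (r * y + 1 <= x * s)%N by lia.
  have h1 : (q * (r * y + 1) <= q * (x * s))%N by rewrite leq_mul2l gt orbT.
  have h2 : (y * (p * s + 1) <= y * (r * q))%N by rewrite leq_mul2l; lia.
  have h3 : (q * x * s = (p * y + 1) * s)%N by rewrite exy.
  by nia.
have sy : (s %| y)%N.
  rewrite -(@Gauss_dvdr s r) ?[coprime s r]coprime_sym // e dvdn_mull //.
have ys : (y %| s)%N.
  by rewrite -(@Gauss_dvdr y x) ?[coprime y x]coprime_sym // -e dvdn_mull.
have esy : s = y by apply/eqP; rewrite eqn_dvd sy ys.
have er : r = x.
  by apply/eqP; rewrite -(@eqn_pmul2r y) // e esy.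
by split; nia.
Qed.

(** * Closure properties of [Theta] and explicit stochastic matrices *)

Lemma Theta_conj (R : realType) n (z : R[i]) : Theta n z -> Theta n z^*.
Proof.
move=> [A [sA /eigenvalueP[v ev vn0]]]; exists A; split=> //.
apply/eigenvalueP; exists (map_mx conjc v).
  rewrite -[in RHS](map_mxZ (conjc : {rmorphism R[i] -> R[i]})) -ev map_mxM.
  by congr (_ *m _); apply/matrixP => i j; rewrite !mxE [RHS]conjc_real.
by rewrite (map_mx_eq0 (conjc : {rmorphism R[i] -> R[i]})).
Qed.

Lemma boundary_Theta_conj (R : realType) n (z : R[i]) :
  boundary (@Theta R n) z -> boundary (@Theta R n) z^*.
Proof.
move=> bz e e0; have [[x [Tx xz]] [y [nTy yz]]] := bz e e0.
split; [exists x^*; split; first exact: Theta_conj|exists y^*; split].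
- by rewrite -rmorphB normcJ.
- by move=> /Theta_conj; rewrite conjcK.
- by rewrite -rmorphB normcJ.
Qed.

(* A left eigenvector for an eigenvalue other than 1 is orthogonal to the
   all-ones vector, so mixing with the uniform matrix only rescales it. *)
Lemma Theta_scale (R : realType) n (z : R[i]) (c : R) :
  Theta n z -> z != 1 -> 0 <= c <= 1 -> Theta n (c%:C * z).
Proof.
move=> [A [[A0 A1] /eigenvalueP[v ev vn0]]] z1 /andP[c0 c1].
have n0 : (0 < n)%N.
  by rewrite lt0n; apply/eqP => n0; move: vn0; subst n; rewrite thinmx0 eqxx.
have nn0 : (n%:R : R) != 0 by rewrite pnatr_eq0 -lt0n.
have sv : \sum_j v 0 j = 0.
  have e : \sum_j v 0 j = z * \sum_j v 0 j.
    rewrite mulr_sumr.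
    transitivity (\sum_j \sum_k v 0 k * (A k j)%:C).
      rewrite exchange_big /=; apply: eq_bigr => k _.
      by rewrite -mulr_sumr -rmorph_sum A1 mulr1.
    apply: eq_bigr => j _; have := congr1 (fun w : 'rV_n => w 0 j) ev.
    by rewrite !mxE => <-; apply: eq_bigr => k _; rewrite !mxE.
  apply/eqP; move: e => /eqP; rewrite -subr_eq0 -{1}[\sum_j v 0 j]mul1r -mulrBl.
  by rewrite mulf_eq0 subr_eq0 eq_sym (negPf z1).
exists (\matrix_(i, j) (c * A i j + (1 - c) / n%:R)); split.
  split=> [i j|i].
    by rewrite !mxE addr_ge0 ?mulr_ge0 ?invr_ge0 ?ler0n // subr_ge0.
  under eq_bigr do rewrite mxE.
  rewrite big_split /= -mulr_sumr A1 sumr_const card_ord -[_ *+ n]mulr_natr.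
  by rewrite divfK // mulr1; ring.
apply/eigenvalueP; exists v => //; apply/matrixP => i j; rewrite !mxE (ord1 i).
transitivity (\sum_k (c%:C * (v 0 k * (A k j)%:C) + ((1 - c) / n%:R)%:C * v 0 k)).
  by apply: eq_bigr => k _; rewrite !mxE rmorphD rmorphM /=; ring.
rewrite big_split /= -!mulr_sumr sv mulr0 addr0.
have := congr1 (fun w : 'rV_n => w 0 j) ev; rewrite !mxE => e.
by rewrite -mulrA -e; congr (_ * _); apply: eq_bigr => k _; rewrite !mxE.
Qed.

(** [eigenvalue] refers to row vectors; a matrix and its transpose share the characteristic
    polynomial. *)
Lemma eigenvalue_right (F : fieldType) n (A : 'M[F]_n) (a : F) (u : 'cV_n) :
  A *m u = a *: u -> u != 0 -> eigenvalue A a.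
Proof.
move=> Au un0; rewrite eigenvalue_root_char /root.
have -> : char_poly A = char_poly A^T.
  rewrite /char_poly -det_tr; congr (\det _).
  by rewrite /char_poly_mx linearB /= tr_scalar_mx map_trmx.
rewrite -/(root _ _) -eigenvalue_root_char; apply/eigenvalueP; exists u^T.
  by rewrite -trmx_mul Au linearZ.
by rewrite -[0]trmx0 (inj_eq trmx_inj).
Qed.

(* The chain counts down to 0; a state [q * k < q * d] restarts its block of
   length [q] with probability [be], and state 0 otherwise jumps to [s.-1].
   Its cycles are [d] disjoint ones of length [q] and one of length [s]
   meeting all of them. *)
Lemma Theta_cycles (R : realType) (n q s : nat) (al be : R) (t : R[i]) :
  (1 < q <= n)%N -> (q * (n %/ q).-1 < s <= n)%N ->
  0 <= al -> 0 <= be -> al + be = 1 -> t != 0 ->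
  1 - be%:C / t ^+ q != 0 ->
  (1 - be%:C / t ^+ q) ^+ (n %/ q) * t ^+ s = (al ^+ (n %/ q))%:C ->
  Theta n t.
Proof.
move=> /andP[q1 qn] /andP[ss sn] al0 be0 ab t0.
set v := 1 - _; set d := (n %/ q)%N => v0 e.
have d0 : (0 < d)%N by rewrite divn_gt0; lia.
have qd : (q * d <= n)%N by rewrite mulnC leq_trunc_div.
pose ta (m : nat) : nat := if m == 0%N then s.-1 else m.-1.
pose tb (m : nat) : nat := if (q %| m)%N && (m < q * d)%N then (m + q).-1%N else m.-1.
have ta_lt (m : 'I_n) : (ta m < n)%N.
  by rewrite /ta; have := ltn_ord m; case: eqP; lia.
have tb_lt (m : 'I_n) : (tb m < n)%N.
  rewrite /tb; have := ltn_ord m; case: ifP => [/andP[/dvdnP[k ->] kd]|_]; last by lia.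
  have : (k < d)%N by rewrite -(@ltn_pmul2l q); lia.
  by nia.
pose M := \matrix_(i < n, j < n) (al * (j == ta i :> nat)%:R + be * (j == tb i :> nat)%:R).
have sumM (m : 'I_n) (f : nat -> R[i]) :
    \sum_(j < n) (M m j)%:C * f j = al%:C * f (ta m) + be%:C * f (tb m).
  transitivity (\sum_(j < n) (al%:C * ((j == ta m :> nat)%:R * f j)
       + be%:C * ((j == tb m :> nat)%:R * f j))).
    by apply: eq_bigr => j _; rewrite mxE rmorphD !rmorphM !rmorph_nat /=; ring.
  rewrite big_split /= -!mulr_sumr.
  have one k : (k < n)%N -> \sum_(j < n) (j == k :> nat)%:R * f j = f k.
    move=> kn; rewrite (bigD1 (Ordinal kn)) //= eqxx mul1r big1 ?addr0 // => j.
    by rewrite -val_eqE /= => /negPf ->; rewrite mul0r.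
  by rewrite !one.
exists M; split.
  split=> [i j|i]; first by rewrite mxE addr_ge0 // mulr_ge0.
  apply: (@complexI R); rewrite rmorph_sum /=.
  by have := sumM i (fun=> 1); rewrite -mulr_suml !mulr1 => ->; rewrite -rmorphD /= ab.
(* The eigenvector [f] is divided by [t] at each step up and multiplied by [k] at each block start
   [q * c] with [0 < c < d]. There the eigenvalue equation reads [k = al + be k / t ^ q], that is
   [k v = al]. *)
pose k := al%:C / v.
pose f m := k ^+ minn (m %/ q) d.-1 / t ^+ m.
have f0 : f 0%N = 1 by rewrite /f div0n min0n !expr0 divr1.
apply: (@eigenvalue_right _ _ _ _ (\col_(i < n) f i)); last first.
  have n0 : (0 < n)%N by lia.
  apply/eqP => /matrixP /(_ (Ordinal n0) 0); rewrite !mxE /= f0 => /eqP.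
  by rewrite oner_eq0.
apply/matrixP => m z; rewrite !mxE.
transitivity (\sum_(j < n) (M m j)%:C * f j); first by apply: eq_bigr => j _; rewrite !mxE.
rewrite sumM; have tX i : t ^+ i != 0 by rewrite expf_neq0.
have ev : be%:C / t ^+ q = 1 - v by rewrite /v; ring.
have ek : k * v = al%:C by rewrite /k divfK.
have fS c i j : (0 < j)%N -> be%:C * (c / t ^+ (i + j).-1) = t * (be%:C / t ^+ j) * (c / t ^+ i).
  case: j => // j _; rewrite addnS /= exprD exprS.
  by field; rewrite !tX t0.
have [m0|mp] := eqVneq (m : nat) 0%N.
  rewrite m0 f0 mulr1 /ta /tb eqxx dvdn0 /= muln_gt0 d0 (_ : (0 < q)%N) /=; last by lia.
  rewrite /f add0n (divn_small (_ : q.-1 < q)%N); last by lia.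
  rewrite min0n expr0 -[q.-1]/(0 + q).-1 fS; last by lia.
  rewrite ev expr0 divr1 mulr1.
  (* Since [q * d.-1 < s], the state [s.-1] is not below the last block start, so the full power of
     [k] is reached and [e] closes the equation at state 0. *)
  have -> : minn (s.-1 %/ q) d.-1 = d.-1.
    apply/minn_idPr; rewrite leq_divRL; last by clear -q1; lia.
    by move: ss; rewrite -/d mulnC; clear; lia.
  have -> : al%:C * (k ^+ d.-1 / t ^+ s.-1) = t * v.
    have s0 : (0 < s)%N by lia.
    have e' : v ^+ d.-1 * v * (t * t ^+ s.-1) = al%:C * al%:C ^+ d.-1.
      by rewrite -exprSr -!exprS !prednK // e rmorphXn.
    rewrite /k expr_div_n.
    transitivity (v ^+ d.-1 * v * (t * t ^+ s.-1) / (v ^+ d.-1 * t ^+ s.-1)).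
      by rewrite e'; field; rewrite !expf_neq0.
    by field; rewrite !expf_neq0.
  by rewrite /v; ring.
have m0 : (0 < m)%N by lia.
have tm : t ^+ m = t * t ^+ m.-1 by rewrite -exprS prednK.
rewrite /ta (negPf mp) /tb; case: ifP => [/andP[/dvdnP[c mc] mq]|h].
  have c0 : (0 < c)%N by lia.
  have cd : (c < d)%N by rewrite -(@ltn_pmul2l q); lia.
  have e1 : (m.-1 %/ q = c.-1)%N.
    have -> : (m.-1 = c.-1 * q + q.-1)%N by nia.
    by rewrite divnMDl ?divn_small ?addn0; lia.
  have e2 : ((m + q).-1 %/ q = c)%N.
    have -> : ((m + q).-1 = c * q + q.-1)%N by lia.
    by rewrite divnMDl ?divn_small ?addn0; lia.
  have e3 : (m %/ q = c)%N by rewrite mc mulnK; lia.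
  rewrite /f e1 e2 e3.
  have cd1 : (c <= d.-1)%N by rewrite -ltnS prednK.
  rewrite (minn_idPl cd1) (minn_idPl (leq_trans (leq_pred c) cd1)).
  rewrite fS; last exact: ltnW.
  rewrite ev -(prednK c0) exprS /= tm -ek.
  by field; rewrite !expf_neq0.
have -> : f m = f m.-1 / t.
  rewrite /f tm.
  have -> : minn (m %/ q) d.-1 = minn (m.-1 %/ q) d.-1.
    have [qm|qm] := boolP (q %| m)%N.
      (* A multiple of [q] that does not restart is at least [q * d], where the exponent is already
         capped. *)
      have dm : (q * d <= m)%N by move: h; rewrite qm /=; lia.
      have : (d.-1 <= m.-1 %/ q)%N by rewrite leq_divRL; nia.
      have : (d.-1 <= m %/ q)%N by rewrite leq_divRL; nia.
      by lia.
    have -> : (m %/ q = m.-1 %/ q)%N; last by [].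
    have := divn_eq m q; move: qm; rewrite /dvdn => qm em.
    have ltm : (m %% q < q)%N by rewrite ltn_pmod; lia.
    have -> : (m.-1 = m %/ q * q + (m %% q).-1)%N by lia.
    rewrite divnMDl; last by clear -q1; lia.
    by rewrite (@divn_small (m %% q).-1) ?addn0 //; clear -ltm; lia.
  by field; rewrite ?tX ?t0.
rewrite -mulrDl -rmorphD /= ab mul1r mulrC divfK //.
Qed.

(** * Complex numbers in polar form *)

Definition cis (R : realType) (x : R) : R[i] := Complex (cos x) (sin x).

Lemma cisD (R : realType) (x y : R) : cis (x + y) = cis x * cis y.
Proof.
by rewrite /cis sinD cosD; apply/eqP; rewrite eq_complex /= eqxx /= addrC (mulrC (cos x)) (mulrC (sin x)) addrC eqxx.
Qed.

Lemma cis0 (R : realType) : cis (0 : R) = 1.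
Proof. by rewrite /cis sin0 cos0. Qed.

Lemma cisMn (R : realType) (x : R) (n : nat) : cis x ^+ n = cis (n%:R * x).
Proof.
elim: n => [|n IH]; first by rewrite expr0 mul0r cis0.
by rewrite exprS IH -cisD -natr1 mulrDl mul1r addrC.
Qed.

Lemma cis_neq0 (R : realType) (x : R) : cis x != 0.
Proof.
apply/eqP => e; have := cisD x (- x).
by rewrite subrr cis0 e mul0r => /eqP; rewrite oner_eq0.
Qed.

Lemma cisN (R : realType) (x : R) : cis (- x) = (cis x)^-1.
Proof.
by apply: (mulfI (cis_neq0 x)); rewrite -cisD subrr cis0 divff // cis_neq0.
Qed.

Lemma conj_cis (R : realType) (x : R) : (cis x)^* = cis (- x).
Proof. by rewrite /cis sinN cosN. Qed.

Lemma norm_cis (R : realType) (x : R) : `|cis x| = 1.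
Proof. by rewrite normc_def /= cos2Dsin2 sqrtr1. Qed.

Lemma cis_2pi_nat (R : realType) (k : nat) : cis (2 * pi * k%:R : R) = 1.
Proof.
rewrite [X in cis X]mulrC -cisMn (_ : cis (2 * pi) = 1) ?expr1n //.
by rewrite /cis mulrC mulr_natr cos2pi sin2pi.
Qed.

Lemma norm_real_complex (R : realType) (x : R) : 0 <= x -> `|x%:C| = x%:C.
Proof. by move=> x0; rewrite ger0_norm // ler0c. Qed.

(** [acos] takes its values in [[0, pi]], where the sine is the nonnegative square root, so the
    closed upper half plane needs no case split by quadrant. *)
Lemma polar_upper (R : realType) (z : R[i]) : 0 <= complex.Im z ->
  exists r w : R, [/\ 0 <= r, 0 <= w <= pi & z = r%:C * cis w].
Proof.
case: z => a b /= b0; have [ab0|abn0] := eqVneq (a ^+ 2 + b ^+ 2) 0.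
  exists 0, 0; split; rewrite ?lexx ?pi_ge0 // mul0r.
  move/eqP: ab0; rewrite paddr_eq0 ?sqr_ge0 // !sqrf_eq0.
  by move=> /andP[/eqP -> /eqP ->].
pose r := Num.sqrt (a ^+ 2 + b ^+ 2).
have r2 : r ^+ 2 = a ^+ 2 + b ^+ 2 by rewrite sqr_sqrtr // addr_ge0 ?sqr_ge0.
have r0 : 0 < r by rewrite sqrtr_gt0 lt_neqAle eq_sym abn0 addr_ge0 ?sqr_ge0.
have ar : -1 <= a / r <= 1.
  rewrite ler_pdivlMr // ler_pdivrMr // mulN1r mul1r -ler_norml.
  rewrite -(@ler_pXn2r _ 2) ?nnegrE ?normr_ge0 ?(ltW r0) //.
  by rewrite r2 real_normK ?num_real // lerDl sqr_ge0.
exists r, (acos (a / r)); split; first exact: ltW.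
  by rewrite acos_ge0 // acos_lepi.
apply/eqP; rewrite eq_complex /= acosK ?in_itv //= sin_acos //.
have -> : r * (a / r) - 0 * Num.sqrt (1 - (a / r) ^+ 2) = a.
  by field; rewrite gt_eqF.
rewrite eqxx mul0r addr0 /=.
have -> : 1 - (a / r) ^+ 2 = (b / r) ^+ 2.
  have eb : b ^+ 2 = r ^+ 2 - a ^+ 2 by rewrite r2; ring.
  by rewrite !expr_div_n eb; field; rewrite gt_eqF.
rewrite sqrtr_sqr ger0_norm ?divr_ge0 ?(ltW r0) //.
by apply/eqP; field; rewrite gt_eqF.
Qed.

(** * From roots of [phi] to triangles *)

(** Division by [z ^ (q d - s)] removes the possibly negative exponent and leaves the eigenvalue
    equation of [Theta_cycles]. *)
Lemma phi_rootE (R : realType) (n q s : nat) (al : R) (z : R[i]) : z != 0 ->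
  phi n q s al z = 0 ->
  (1 - (1 - al)%:C / z ^+ q) ^+ (n %/ q) * z ^+ s = (al ^+ (n %/ q))%:C.
Proof.
move=> z0 /eqP; rewrite /phi subr_eq0 => /eqP e.
have zX i : z ^+ i != 0 by rewrite expf_neq0.
have -> : 1 - (1 - al)%:C / z ^+ q = (z ^+ q - (1 - al)%:C) / z ^+ q.
  by field.
rewrite expr_div_n e expfzDr // -exprnN -exprnP -exprM.
by rewrite rmorphXn; field; rewrite !zX.
Qed.

(** The number [1 - beta / z ^ q] lies in the closed upper half plane, since [z ^ q] has argument
    [psi]. The modulus of the equation makes its modulus [al / tau ^ s]; its real and imaginary
    parts are the projections of the triangle, and the phase of the equation is the last claim. *)
Lemma triangle_of_root (R : realType) (q s d : nat) (al tau psi : R) (u : R[i]) :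
  (0 < d)%N -> 0 < al -> al <= 1 -> 0 < tau -> 0 <= psi <= pi ->
  `|u| = 1 -> u ^+ q = cis psi ->
  let z := (tau ^+ d)%:C * u in
  (1 - (1 - al)%:C / z ^+ q) ^+ d * z ^+ s = (al ^+ d)%:C ->
  exists w, [/\ 0 <= w <= pi,
    al / tau ^+ s * cos w + (1 - al) / tau ^+ (d * q) * cos psi = 1,
    al / tau ^+ s * sin w = (1 - al) / tau ^+ (d * q) * sin psi
    & cis w ^+ d * u ^+ s = 1].
Proof.
move=> d0 al0 al1 tau0 psi0 nu uq z e.
pose b := (1 - al) / tau ^+ (d * q).
have b0 : 0 <= b by rewrite divr_ge0 ?exprn_ge0 ?subr_ge0 // ltW.
have tX i : tau ^+ i != 0 by rewrite expf_neq0 // gt_eqF.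
have ev : 1 - (1 - al)%:C / z ^+ q = 1 - b%:C * cis (- psi).
  rewrite /z exprMn uq cisN /b rmorphM /= fmorphV /= -rmorphXn -exprM.
  by rewrite invfM mulrA.
have [r [w [r0 wpi evw]]] : exists r w : R, [/\ 0 <= r, 0 <= w <= pi &
    1 - b%:C * cis (- psi) = r%:C * cis w].
  apply: polar_upper => /=.
  rewrite sinN mul0r addr0 mulrN opprK add0r mulr_ge0 // sin_ge0_pi //.
rewrite ev evw in e.
have er : r = al / tau ^+ s.
  apply: (mulIf (tX s)); rewrite divfK //.
  apply/eqP; rewrite -(@eqrXn2 _ d) ?mulr_ge0 ?exprn_ge0 ?(ltW tau0) ?(ltW al0) //.
  apply/eqP/(@complexI R).
  have := congr1 Num.norm e.
  rewrite normrM !normrX normrM /z normrM nu norm_cis !norm_real_complex ?exprn_ge0 ?(ltW tau0) ?(ltW al0) //.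
  by rewrite !mulr1 exprMn rmorphM /= !rmorphXn /= -!exprM mulnC.
exists w; split => //.
- have := congr1 (@complex.Re R) evw; rewrite /= cosN sinN er -/b; lra.
- have := congr1 (@complex.Im R) evw; rewrite /= cosN sinN er -/b; lra.
have aln0 : (al ^+ d)%:C != 0 by rewrite (inj_eq (@complexI R)) expf_neq0 // gt_eqF.
apply: (mulfI aln0); rewrite mulr1 -[RHS]e /z !exprMn.
have -> : (al ^+ d)%:C = r%:C ^+ d * (tau ^+ d)%:C ^+ s.
  by rewrite -!rmorphXn -rmorphM /= er -exprM (mulnC d s) exprM -exprMn divfK.
by ring.
Qed.

Lemma law_of_sines_left (R : realType) (al be S T x y : R) : 0 < S ->
  al / S * cos y + be / T * cos x = 1 -> al / S * sin y = be / T * sin x ->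
  al * sin (x + y) = S * sin x.
Proof.
move=> S0 re im; have -> : al = S * (al / S) by rewrite mulrC divfK ?gt_eqF.
rewrite sinD -mulrA; congr (_ * _).
transitivity (sin x * (al / S * cos y) + cos x * (al / S * sin y)); first by ring.
by rewrite im (_ : al / S * cos y = 1 - be / T * cos x); [ring | rewrite -re; ring].
Qed.

Lemma law_of_sines_right (R : realType) (al be S T x y : R) : 0 < T ->
  al / S * cos y + be / T * cos x = 1 -> al / S * sin y = be / T * sin x ->
  be * sin (x + y) = T * sin y.
Proof.
move=> T0 re im; have -> : be = T * (be / T) by rewrite mulrC divfK ?gt_eqF.
rewrite sinD -mulrA; congr (_ * _).
transitivity ((be / T * sin x) * cos y + sin y * (be / T * cos x)); first by ring.
by rewrite -im (_ : be / T * cos x = 1 - al / S * cos y); [ring | rewrite -re; ring].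
Qed.

Lemma triangle_inequality (R : realType) (al be S T x y : R) :
  0 <= al -> 0 <= be -> 0 < S -> 0 < T ->
  al / S * cos y + be / T * cos x = 1 ->
  1 <= al / S + be / T.
Proof.
move=> al0 be0 S0 T0 re; have a0 : 0 <= al / S by rewrite divr_ge0 // ltW.
have b0 : 0 <= be / T by rewrite divr_ge0 // ltW.
have hx : be / T * cos x <= be / T by rewrite ler_piMr ?cos_le1.
have hy : al / S * cos y <= al / S by rewrite ler_piMr ?cos_le1.
by rewrite -re lerD.
Qed.

(** * Points of [Theta] on and below the arc *)

(** Rotation by [- th] moves the centre to the positive real axis, where a nearby [a + i b] has
    argument [atan (b / a)]. *)
Lemma polar_near (R : realType) (rho th del : R) : 0 < rho -> 0 < del ->
  exists2 e : R, 0 < e & forall z : R[i], `|z - rho%:C * cis th| < e%:C ->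
    exists eta r : R, [/\ `|eta| < del, 0 <= r, r < rho + del
                       & z = r%:C * cis (th + eta)].
Proof.
move=> rho0 del0.
have [k k0 hk] : exists2 k : R, 0 < k & forall x : R, `|x| < k -> `|atan x| < del.
  have : ((atan : R -> R) x @[x --> (0 : R)] --> atan (0 : R))%classic.
    exact: (@continuous_atan R 0).
  rewrite atan0 => /cvgrPdist_lt /(_ _ del0) /nbhs_ballP[k /= k0 hk]; exists k => // x xk.
  by have := hk x; rewrite /ball /= !sub0r !normrN; apply.
(* The bounds keep [a] above [rho / 2], the modulus below [rho + del], and [b / a] below [k] in
   absolute value. *)
pose e := Num.min (rho / 2) (Num.min del (k * (rho / 2))).
have e0 : 0 < e by rewrite !lt_min del0 divr_gt0 // mulr_gt0 // divr_gt0.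
have e1 : e <= rho / 2 by rewrite ge_min lexx.
have e2 : e <= del by rewrite !ge_min lexx orbT.
have e3 : e <= k * (rho / 2) by rewrite !ge_min lexx !orbT.
exists e => // z ze.
pose w := z * cis (- th).
have ew : `|w - rho%:C| < e%:C.
  have -> : w - rho%:C = (z - rho%:C * cis th) * cis (- th).
    by rewrite mulrBl -mulrA -cisD subrr cis0 mulr1.
  by rewrite normrM norm_cis mulr1.
have ez : z = w * cis th by rewrite /w -mulrA -cisD addNr cis0 mulr1.
move: (w) ew ez => [a b]; rewrite normc_def ltcR /= subr0 => lt ez.
have lt2 : (a - rho) ^+ 2 + b ^+ 2 < e ^+ 2.
  by rewrite -(@ltr_sqrt _ _ (e ^+ 2)) ?exprn_gt0 // sqrtr_sqr gtr0_norm.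
have la : `|a - rho| < e.
  by rewrite -(@ltr_pXn2r _ 2) ?nnegrE ?normr_ge0 ?(ltW e0) // real_normK ?num_real //; apply: le_lt_trans lt2; rewrite lerDl sqr_ge0.
have lb : `|b| < e.
  by rewrite -(@ltr_pXn2r _ 2) ?nnegrE ?normr_ge0 ?(ltW e0) // real_normK ?num_real //; apply: le_lt_trans lt2; rewrite lerDr sqr_ge0.
have a0 : rho / 2 < a by move: la; rewrite ltr_norml; lra.
have a00 : 0 < a by lra.
pose r := Num.sqrt (a ^+ 2 + b ^+ 2).
exists (atan (b / a)), r; split.
- apply: hk; rewrite normrM normfV (gtr0_norm a00) ltr_pdivrMr //.
  by apply: (lt_le_trans lb); apply: (le_trans e3); rewrite ler_pM2l // ltW.
- exact: sqrtr_ge0.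
- rewrite -(@ltr_pXn2r _ 2) ?nnegrE ?sqrtr_ge0 ?addr_ge0 ?(ltW rho0) ?(ltW del0) //.
  rewrite sqr_sqrtr ?addr_ge0 ?sqr_ge0 //.
  move: la; rewrite ltr_norml => /andP[_ la].
  nra.
rewrite ez addrC cisD mulrA; congr (_ * _).
have c0 : 0 < 1 + (b / a) ^+ 2 by rewrite ltr_pwDl // sqr_ge0.
have er : r = a * Num.sqrt (1 + (b / a) ^+ 2).
  rewrite -{1}(ger0_norm (ltW a00)) -sqrtr_sqr -sqrtrM ?sqr_ge0 //.
  by congr (Num.sqrt _); field; rewrite gt_eqF.
have cn : cos (atan (b / a)) != 0 by rewrite cos_atan invr_neq0 // gt_eqF // sqrtr_gt0.
have es : sin (atan (b / a)) = b / a * cos (atan (b / a)).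
  by rewrite -{2}(atanK (b / a)) /tan divfK.
have ec : r * cos (atan (b / a)) = a.
  by rewrite cos_atan er mulfK // gt_eqF // sqrtr_gt0.
apply/eqP; rewrite eq_complex /= !mul0r subr0 addr0 ec es eqxx /=.
by rewrite mulrCA ec divfK // gt_eqF.
Qed.

(* The second angle of the triangle, determined by [s x + k y = 2 pi]. *)
Definition coangle (R : realType) (s k : nat) (x : R) : R :=
  (2 * pi - s%:R * x) / k%:R.

Lemma coangleE (R : realType) (s k : nat) (x : R) : (0 < k)%N ->
  s%:R * x + k%:R * coangle s k x = 2 * pi.
Proof.
by move=> k0; rewrite /coangle mulrC; field; rewrite pnatr_eq0 -lt0n.
Qed.

(** With [w] the coangle, [3 x + 2 w <= 2 pi] and [x > 0] force [x + w < pi]. *)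
Lemma coangle_bounds (R : realType) (s k : nat) (x : R) :
  (2 < s)%N -> (1 < k)%N -> 0 < x -> s%:R * x < 2 * pi ->
  0 < coangle s k x /\ x + coangle s k x < pi.
Proof.
move=> s2 k1 x0 xs.
have w0 : 0 < coangle s k x.
  by rewrite divr_gt0 ?subr_gt0 // ltr0n; lia.
split => //; have := coangleE s x (ltnW k1).
have h1 : (3 : R) <= s%:R by rewrite ler_nat; lia.
have h2 : (2 : R) <= k%:R by rewrite ler_nat; lia.
by nra.
Qed.

(** The law of sines read backwards: the angles define [al] and [be], and the hypothesis on [tau]
    says [al + be = 1]. *)
Lemma Theta_arc (R : realType) (n p q r s : nat) (x tau : R) :
  (1 < q)%N -> (q < s)%N -> (s <= n)%N ->
  (r * q = p * s + 1)%N -> (n < q + s)%N ->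
  let d := (n %/ q)%N in
  0 < x -> s%:R * x < 2 * pi -> 0 < tau ->
  sin x * tau ^+ s + sin (coangle s (q * d) x) * tau ^+ (d * q) = sin (x + coangle s (q * d) x) ->
  Theta n ((tau ^+ d)%:C * cis ((x + 2 * pi * p%:R) / q%:R)).
Proof.
move=> q1 qs sn det nqs d x0 xs tau0 e; have d0 : (0 < d)%N by rewrite divn_gt0 ?(leq_trans (ltnW qs) sn) // ltnW.
have s2 : (2 < s)%N by apply: leq_ltn_trans q1 qs.
have qd1 : (1 < q * d)%N by clear -q1 d0; nia.
have [w0 wpi] := coangle_bounds s2 qd1 x0 xs; have ew := coangleE s x (ltnW qd1).
set w := coangle s (q * d) x in w0 wpi ew e *; set z := _ * cis _.
have sx : 0 < sin x by apply: sin_gt0_pi; apply/andP; split; lra.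
have sw : 0 < sin w by apply: sin_gt0_pi; apply/andP; split; lra.
have sS : 0 < sin (x + w) by apply: sin_gt0_pi; apply/andP; split; lra.
have q0 : (q%:R : R) != 0 by rewrite pnatr_eq0 -lt0n ltnW.
have tX i : tau ^+ i != 0 by rewrite expf_neq0 // gt_eqF.
pose al := tau ^+ s * sin x / sin (x + w).
pose be := tau ^+ (d * q) * sin w / sin (x + w).
have zq : z ^+ q = (tau ^+ (d * q))%:C * cis x.
  rewrite exprMn cisMn -rmorphXn /= -exprM; congr (_ * _).
  by rewrite mulrC divfK // cisD cis_2pi_nat mulr1.
have ev : 1 - be%:C / z ^+ q = (sin x / sin (x + w))%:C * cis w.
  have -> : be%:C / z ^+ q = (sin w / sin (x + w))%:C * cis (- x).
    rewrite zq invfM mulrA cisN -fmorphV -rmorphM /=; congr (_%:C * _).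
    by rewrite /be; field; rewrite tX gt_eqF.
  apply/eqP; rewrite eq_complex /= cosN sinN !mul0r subr0 addr0.
  by apply/andP; split; apply/eqP; rewrite sinD in sS *; field; rewrite gt_eqF.
have cX : (sin x / sin (x + w))%:C != 0.
  by rewrite (inj_eq (@complexI R)) gt_eqF // divr_gt0.
apply: (@Theta_cycles _ n q s al be).
- by rewrite q1 (leq_trans (ltnW qs) sn).
- rewrite sn andbT; have : (q * d <= n)%N by rewrite mulnC leq_trunc_div.
  rewrite -{1}(prednK d0) mulnS; move: (q * d.-1)%N => e'.
  by clear -nqs; lia.
- by rewrite /al divr_ge0 ?mulr_ge0 ?exprn_ge0 // ltW.
- by rewrite /be divr_ge0 ?mulr_ge0 ?exprn_ge0 // ltW.
- by rewrite /al /be -mulrDl mulrC (mulrC (tau ^+ s)) (mulrC (tau ^+ (d * q))) e mulVf ?gt_eqF.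
- by rewrite mulf_neq0 ?cis_neq0 // (inj_eq (@complexI R)).
- by rewrite ev mulf_neq0 // cis_neq0.
rewrite ev /z !exprMn !cisMn mulrACA -cisD.
(* Here the Farey determinant enters: [s x + q d w + 2 pi p s = 2 pi (p s + 1) = 2 pi r q]. *)
have -> : d%:R * w + s%:R * ((x + 2 * pi * p%:R) / q%:R) = 2 * pi * r%:R.
  have hdet : r%:R * q%:R = p%:R * s%:R + 1 :> R by rewrite -!natrM det natrD.
  apply: (mulIf q0).
  transitivity (s%:R * x + (q * d)%:R * w + 2 * pi * (p%:R * s%:R)).
    by rewrite natrM; field.
  by rewrite ew -[RHS]mulrA hdet; ring.
rewrite cis_2pi_nat mulr1 -!rmorphXn -rmorphM /=; congr (_%:C).
by rewrite -exprM (mulnC d) exprM -!exprMn; congr (_ ^+ _); ring.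
Qed.

(** At scale 1 the sum of the sines is at least the sine of the sum, so the intermediate value
    theorem gives a scale [u >= tau] with equality. That point is in [Theta], and shrinking it
    covers the ray. *)
Lemma Theta_ray (R : realType) (n p q r s : nat) (x tau c : R) :
  (1 < q)%N -> (q < s)%N -> (s <= n)%N ->
  (r * q = p * s + 1)%N -> (n < q + s)%N ->
  let d := (n %/ q)%N in
  0 < x -> s%:R * x < 2 * pi -> 0 < tau ->
  sin x * tau ^+ s + sin (coangle s (q * d) x) * tau ^+ (d * q) < sin (x + coangle s (q * d) x) ->
  0 <= c <= tau ^+ d ->
  Theta n (c%:C * cis ((x + 2 * pi * p%:R) / q%:R)).
Proof.
move=> q1 qs sn det nqs d x0 xs tau0 lt /andP[c0 ct]; have d0 : (0 < d)%N by rewrite divn_gt0 ?(leq_trans (ltnW qs) sn) // ltnW.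
have s2 : (2 < s)%N by apply: leq_ltn_trans q1 qs.
have qd1 : (1 < q * d)%N by clear -q1 d0; nia.
have [w0 wpi] := coangle_bounds s2 qd1 x0 xs.
have sx : 0 < sin x by apply: sin_gt0_pi; apply/andP; split; lra.
have sw : 0 < sin (coangle s (q * d) x) by apply: sin_gt0_pi; apply/andP; split; lra.
have sS : sin (x + coangle s (q * d) x) <= sin x + sin (coangle s (q * d) x).
  by rewrite sinD; have := cos_le1 x; have := cos_le1 (coangle s (q * d) x); nra.
have tau1 : tau <= 1.
  rewrite leNgt; apply/negP => t1.
  have h1 : 1 <= tau ^+ s by rewrite exprn_ege1 // ltW.
  have h2 : 1 <= tau ^+ (d * q) by rewrite exprn_ege1 // ltW.
  by have := lt_le_trans lt sS; rewrite ltNge lerD // ler_peMr // ltW.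
pose f (u : R) := sin x * u ^+ s + sin (coangle s (q * d) x) * u ^+ (d * q).
have fc : continuous f.
  move=> u; apply: cvgD; (apply: cvgM; first exact: cvg_cst); exact: exprn_continuous.
have [|u /itvP uI fu] := @IVT R f tau 1 (sin (x + coangle s (q * d) x)) tau1
  (continuous_subspaceT fc).
  have -> : f 1 = sin x + sin (coangle s (q * d) x) by rewrite /f !expr1n !mulr1.
  by rewrite ge_min le_max (ltW lt) sS orbT.
have u0 : 0 < u by apply: lt_le_trans tau0 _; rewrite uI.
have ud : 0 < u ^+ d by rewrite exprn_gt0.
have T := Theta_arc q1 qs sn det nqs x0 xs u0 fu.
have -> : c%:C * cis ((x + 2 * pi * p%:R) / q%:R) =
   (c / u ^+ d)%:C * ((u ^+ d)%:C * cis ((x + 2 * pi * p%:R) / q%:R)).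
  by rewrite mulrA -rmorphM /= divfK // gt_eqF.
apply: Theta_scale => //; last first.
  rewrite divr_ge0 ?(ltW ud) // ler_pdivrMr // mul1r /=.
  by apply: (le_trans ct); apply: lerXn2r; rewrite ?nnegrE ?(ltW tau0) ?(ltW u0) ?uI.
(* Shrinking needs an eigenvalue other than 1; the [q]-th power of this one has imaginary part
   [u ^ (d q) sin x > 0]. *)
apply/eqP => z1; have : (u ^+ (d * q))%:C * cis x = 1.
  rewrite -[RHS](expr1n _ q) -[X in _ = X ^+ q]z1 exprMn cisMn -rmorphXn /= -exprM.
  have q0 : (q%:R : R) != 0 by rewrite pnatr_eq0 -lt0n ltnW.
  have -> : q%:R * ((x + 2 * pi * p%:R) / q%:R) = x + 2 * pi * p%:R by field.
  by rewrite cisD cis_2pi_nat mulr1.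
move=> /(congr1 (@complex.Im R)) /=; rewrite mul0r addr0 => /eqP.
by rewrite mulf_eq0 !gt_eqF // exprn_gt0.
Qed.

(** The strict inequality persists at a slightly larger scale [tau2], and then at all angles near
    [x]. The rays of [Theta_ray] at these angles cover a neighbourhood of the point. *)
Lemma arc_interior (R : realType) (n p q r s : nat) (x tau : R) :
  (1 < q)%N -> (q < s)%N -> (s <= n)%N ->
  (r * q = p * s + 1)%N -> (n < q + s)%N ->
  let d := (n %/ q)%N in
  0 < x -> s%:R * x < 2 * pi -> 0 < tau ->
  sin x * tau ^+ s + sin (coangle s (q * d) x) * tau ^+ (d * q) < sin (x + coangle s (q * d) x) ->
  ~ boundary (@Theta R n) ((tau ^+ d)%:C * cis ((x + 2 * pi * p%:R) / q%:R)).
Proof.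
move=> q1 qs sn det nqs d x0 xs tau0 lt bd; have d0 : (0 < d)%N by rewrite divn_gt0 ?(leq_trans (ltnW qs) sn) // ltnW.
have s2 : (2 < s)%N by apply: leq_ltn_trans q1 qs.
have qd1 : (1 < q * d)%N by clear -q1 d0; nia.
have [k k0 hk] : exists2 k : R, 0 < k & forall u, `|tau - u| < k ->
    sin x * u ^+ s + sin (coangle s (q * d) x) * u ^+ (d * q) < sin (x + coangle s (q * d) x).
  pose f (u : R) := sin x * u ^+ s + sin (coangle s (q * d) x) * u ^+ (d * q).
  have fc : continuous f.
    move=> u; apply: cvgD; (apply: cvgM; first exact: cvg_cst); exact: exprn_continuous.
  have /cvgrPdist_lt := fc tau.
  have gap : 0 < sin (x + coangle s (q * d) x) - f tau by rewrite subr_gt0.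
  move=> /(_ _ gap) /nbhs_ballP[k /= k0 hk]; exists k => // u uk.
  by have := hk u uk; rewrite ltr_norml /f; lra.
pose tau2 := tau + k / 2.
have lt2 : sin x * tau2 ^+ s + sin (coangle s (q * d) x) * tau2 ^+ (d * q) < sin (x + coangle s (q * d) x).
  apply: hk; rewrite /tau2 opprD addNKr normrN gtr0_norm ?divr_gt0 //; lra.
have [m m0 hm] : exists2 m : R, 0 < m & forall y, `|x - y| < m ->
    [/\ 0 < y, s%:R * y < 2 * pi &
    sin y * tau2 ^+ s + sin (coangle s (q * d) y) * tau2 ^+ (d * q) < sin (y + coangle s (q * d) y)].
  pose f (y : R) := sin (y + coangle s (q * d) y) - sin y * tau2 ^+ s
     - sin (coangle s (q * d) y) * tau2 ^+ (d * q).
  have cc : continuous (@coangle R s (q * d)).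
    move=> y; apply: cvgM; last exact: cvg_cst.
    apply: cvgB; first exact: cvg_cst.
    by apply: cvgM; [exact: cvg_cst | exact: cvg_id].
  have fc : continuous f.
    move=> y; apply: cvgB; first apply: cvgB.
    - apply: (@continuous_comp _ _ _ (fun y : R => y + coangle s (q * d) y) sin).
        by apply: cvgD; [exact: cvg_id | exact: cc].
      exact: continuous_sin.
    - by apply: cvgM; [exact: continuous_sin | exact: cvg_cst].
    - apply: cvgM; last exact: cvg_cst.
      by apply: (@continuous_comp _ _ _ (@coangle R s (q * d)) sin); [exact: cc | exact: continuous_sin].
  have /cvgrPdist_lt := fc x.
  have gap : 0 < f x by rewrite /f; lra.
  move=> /(_ _ gap) /nbhs_ballP[k' /= k'0 hk'].
  have s0 : 0 < s%:R :> R by rewrite ltr0n ltnW // ltnW.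
  exists (Num.min k' (Num.min x ((2 * pi - s%:R * x) / s%:R))).
    by rewrite !lt_min k'0 x0 divr_gt0 // subr_gt0.
  move=> y; rewrite !lt_min => /and3P[yk yx ys]; split.
  - by move: yx; rewrite ltr_norml; lra.
  - move: ys; rewrite ltr_pdivlMr // => ys.
    have : (y - x) * s%:R <= `|x - y| * s%:R.
      by rewrite ler_pM2r // distrC ler_norm.
    by lra.
  - by have := hk' y yk; rewrite ltr_norml /f; lra.
have tau20 : 0 < tau2 by rewrite addr_gt0 ?divr_gt0.
have tt : tau ^+ d < tau2 ^+ d.
  by rewrite ltr_pXn2r ?nnegrE ?(ltW tau0) ?(ltW tau20) // ltrDl divr_gt0.
have q0 : 0 < q%:R :> R by rewrite ltr0n ltnW.
(* A change [eta] of the argument changes [x] by [q eta], hence the bound [m / q]. *)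
pose del := Num.min (m / q%:R) (tau2 ^+ d - tau ^+ d).
have [||e e0 he] := @polar_near R (tau ^+ d) ((x + 2 * pi * p%:R) / q%:R) del.
- by rewrite exprn_gt0.
- by rewrite lt_min divr_gt0 // subr_gt0.
have [_ [z [nT /he[eta [rz [etad rz0 rzd ez]]]]]] := bd e e0.
apply: nT; rewrite ez.
have [y0 ys ylt] : [/\ 0 < x + q%:R * eta, s%:R * (x + q%:R * eta) < 2 * pi &
    sin (x + q%:R * eta) * tau2 ^+ s + sin (coangle s (q * d) (x + q%:R * eta)) * tau2 ^+ (d * q)
     < sin (x + q%:R * eta + coangle s (q * d) (x + q%:R * eta))].
  apply: hm; rewrite opprD addNKr normrN normrM gtr0_norm // mulrC -ltr_pdivlMr //.
  by apply: (lt_le_trans etad); rewrite ge_min lexx.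
have := Theta_ray q1 qs sn det nqs y0 ys tau20 ylt.
have -> : (x + q%:R * eta + 2 * pi * p%:R) / q%:R = (x + 2 * pi * p%:R) / q%:R + eta.
  by field; rewrite gt_eqF.
apply; rewrite rz0 /=; have : del <= tau2 ^+ d - tau ^+ d by rewrite ge_min lexx orbT.
by lra.
Qed.

(** * Comparison of the scales of two triangles *)

Lemma sin_eq0_0pi (R : realType) (x : R) :
  0 <= x <= pi -> sin x = 0 -> x = 0 \/ x = pi.
Proof.
move=> /andP[x0 xp] s0.
have [->|xn0] := eqVneq x 0; first by left.
have [->|xnp] := eqVneq x pi; first by right.
have := @sin_gt0_pi R x; rewrite s0 ltxx => h.
by exfalso; apply/notF/h; rewrite !lt_neqAle x0 xp xnp eq_sym xn0.
Qed.

Lemma lt_pi_of_sin_gt0 (R : realType) (x : R) : x <= 2 * pi -> 0 < sin x -> x < pi.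
Proof.
move=> x2 sx; rewrite ltNge; apply/negP => xp.
have : 0 <= sin (x - pi) by apply: sin_ge0_pi; apply/andP; split; lra.
by rewrite sinB cospi sinpi; lra.
Qed.

(** Either [x + w] or its reflection [pi - (x + w)] lies between [w] and [pi / 2], where the sine
    increases. *)
Lemma sin_leD (R : realType) (x w : R) : 0 <= x -> 0 <= w -> x + 2 * w <= pi ->
  sin w <= sin (x + w).
Proof.
move=> x0 w0 h.
have p0 := pi_gt0 R.
have mono (a b : R) : - (pi / 2) <= a -> a <= b -> b <= pi / 2 -> sin a <= sin b.
  move=> ha hab hb; have [->//|ne] := eqVneq a b.
  by apply: ltW; rewrite ltr_sin ?in_itv /= ?lt_neqAle ?ne // ?ha ?hb ?(le_trans hab) ?(le_trans ha).
have [le|gt] := lerP (x + w) (pi / 2); first by apply: mono; lra.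
have -> : sin (x + w) = sin (pi - (x + w)) by rewrite [RHS]sinB cospi sinpi; lra.
by apply: mono; lra.
Qed.

Lemma cos_3pi (R : realType) : cos (3 * pi : R) = - 1.
Proof.
have -> : 3 * pi = pi + pi *+ 2 :> R by rewrite mulr2n; ring.
by rewrite cosD2pi cospi.
Qed.

(** Makes the brackets of [ln_sin_triangle_monotone] affine in [ln tau]. *)
Lemma ln_law_of_sines (R : realType) (al S T : R) (k : nat) (tau : R) :
  0 < al -> 0 < S -> 0 < T -> 0 < tau -> al * S = tau ^+ k * T ->
  ln T - ln S = ln al - k%:R * ln tau.
Proof.
move=> al0 S0 T0 tau0 /(congr1 (@ln R)).
rewrite !lnM ?posrE ?exprn_gt0 // lnXn // -mulr_natl => e.
by lra.
Qed.

Lemma triangle_scale_le1 (R : realType) (al tau : R) (s k : nat) :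
  0 < al -> al <= 1 -> 0 < tau -> (0 < s)%N ->
  1 <= al / tau ^+ s + (1 - al) / tau ^+ k -> tau <= 1.
Proof.
move=> al0 al1 tau0 s0 h; rewrite leNgt; apply/negP => t1.
have h1 : al / tau ^+ s < al.
  by rewrite ltr_pdivrMr ?exprn_gt0 // ltr_pMr // exprn_egt1 // -lt0n.
have h2 : (1 - al) / tau ^+ k <= 1 - al.
  rewrite ler_pdivrMr ?exprn_gt0 // ler_peMr ?subr_ge0 //.
  by rewrite exprn_ege1 // ltW.
by lra.
Qed.

(* Nondegenerate triangles are compared by convexity.  The degenerate ones lie
   outside the domain of the logarithms; their phase is [s pi] or [k pi], and
   the case [k = 2] left by parity comes down to [t ^ 2 + t + al = 0]. *)
Lemma triangle_scale_max (R : realType) (s k : nat) (al x w tau x' w' tau' : R) :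
  (2 < s)%N -> (1 < k)%N -> (k = 2 -> s = 3)%N -> 0 < al < 1 ->
  0 < x -> 0 < w -> x + w < pi -> s%:R * x + k%:R * w = 2 * pi ->
  0 < tau -> al * sin (x + w) = tau ^+ s * sin x ->
  (1 - al) * sin (x + w) = tau ^+ k * sin w ->
  0 <= x' <= pi -> 0 <= w' <= pi -> 0 < tau' ->
  al / tau' ^+ s * cos w' + (1 - al) / tau' ^+ k * cos x' = 1 ->
  al / tau' ^+ s * sin w' = (1 - al) / tau' ^+ k * sin x' ->
  cos (s%:R * x' + k%:R * w') = 1 -> ~ (x' = 0 /\ w' = 0) ->
  tau' <= tau.
Proof.
move=> s2 k1 ks /andP[al0 al1] x0 w0 xw ef tau0 l1 l2 x'pi w'pi tau'0 re im c1 nz.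
have s0 : (0 < s)%N by apply: ltn_trans s2.
have k0 : (0 < k)%N by apply: ltn_trans k1.
have be0 : 0 < 1 - al by rewrite subr_gt0.
have Ts i : 0 < tau' ^+ i by rewrite exprn_gt0.
have l1' : al * sin (x' + w') = tau' ^+ s * sin x' := law_of_sines_left (Ts s) re im.
have l2' : (1 - al) * sin (x' + w') = tau' ^+ k * sin w' := law_of_sines_right (Ts k) re im.
have sx : 0 < sin x by apply: sin_gt0_pi; apply/andP; split; lra.
have sw : 0 < sin w by apply: sin_gt0_pi; apply/andP; split; lra.
have sS : 0 < sin (x + w) by apply: sin_gt0_pi; apply/andP; split; lra.
have s3R : (3 : R) <= s%:R by rewrite ler_nat.
have k2R : (2 : R) <= k%:R by rewrite ler_nat.
have p0 := pi_gt0 R.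
have [sx'0|sx'n0] := eqVneq (sin x') 0; last first.
  rewrite leNgt; apply/negP => lt.
  have sx' : 0 < sin x' by rewrite lt_neqAle eq_sym sx'n0 sin_ge0_pi.
  have sS' : 0 < sin (x' + w').
    by rewrite -(pmulr_rgt0 _ al0) l1' mulr_gt0.
  have sw' : 0 < sin w'.
    by rewrite -(pmulr_rgt0 _ (Ts k)) -l2' mulr_gt0.
  move: x'pi w'pi => /andP[x'0 x'p] /andP[w'0 w'p].
  have x'0' : 0 < x'.
    by rewrite lt_neqAle x'0 andbT; apply: contraNneq sx'n0 => <-; rewrite sin0.
  have w'0' : 0 < w'.
    rewrite lt_neqAle w'0 andbT; apply/negP => /eqP e0.
    by move: sw'; rewrite -e0 sin0 ltxx.
  have xw' : x' + w' < pi by apply: lt_pi_of_sin_gt0 => //; lra.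
  have f' : 2 * pi <= s%:R * x' + k%:R * w'.
    have pos : 0 < s%:R * x' + k%:R * w' by nra.
    by have [e|//] := cos_eq1_ge0 (ltW pos) c1; move: pos; rewrite e ltxx.
  have lnlt : ln tau < ln tau' by rewrite ltr_ln ?posrE.
  have [same|ne] := boolP ((x == x') && (w == w')).
    move: same => /andP[/eqP ex /eqP ew]; rewrite -ex -ew in l1'.
    have : tau ^+ s = tau' ^+ s by apply: (mulIf (lt0r_neq0 sx)); rewrite -l1 -l1'.
    have : tau ^+ s < tau' ^+ s.
      by rewrite ltr_pXn2r // ?nnegrE ?(ltW tau0) ?(ltW tau'0).
    by move=> h e; rewrite e ltxx in h.
  rewrite negb_and in ne.
  have := ln_sin_triangle_monotone x0 w0 xw x'0' w'0' xw' ne.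
  rewrite (ln_law_of_sines al0 sS sx tau0 l1) (ln_law_of_sines be0 sS sw tau0 l2).
  rewrite (ln_law_of_sines al0 sS' sx' tau'0 l1') (ln_law_of_sines be0 sS' sw' tau'0 l2').
  set L := ln tau in lnlt *; set L' := ln tau' in lnlt *.
  (* The two brackets are multiples of [L - L'], so only the phase difference remains. A larger
     [tau'] makes [L - L'] negative while the second phase is at least [2 pi], against
     positivity. *)
  have -> : (x' - x) * (ln al - s%:R * L' - (ln al - s%:R * L))
     + (w' - w) * (ln (1 - al) - k%:R * L' - (ln (1 - al) - k%:R * L))
     = (L - L') * (s%:R * x' + k%:R * w' - (s%:R * x + k%:R * w)) by ring.
  rewrite ef ltNge mulr_le0_ge0 // ?subr_ge0 // subr_le0; exact: ltW.
have sw'0 : sin w' = 0.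
  have : al / tau' ^+ s != 0 by rewrite gt_eqF // divr_gt0.
  by move=> h; apply: (mulfI h); rewrite im sx'0 !mulr0.
have pow_lt (i : nat) : (0 < i)%N -> tau' ^+ i < tau ^+ i -> tau' <= tau.
  by move=> i0; rewrite ltr_pXn2r // ?nnegrE ?(ltW tau0) ?(ltW tau'0) // => /ltW.
have a0 : 0 < al / tau' ^+ s by rewrite divr_gt0.
have b0 : 0 < (1 - al) / tau' ^+ k by rewrite divr_gt0.
have [ex'|ex'] := sin_eq0_0pi x'pi sx'0; have [ew'|ew'] := sin_eq0_0pi w'pi sw'0.
- by case: nz.
- rewrite ex' ew' cos0 cospi !mulrN1 !mulr1 mulr0 add0r in re c1.
  (* A collapsed triangle with phase [k pi]. For [k >= 4], [sin w <= sin (x + w)] gives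
     [1 - al <= tau ^ k]; for [k = 3] the phase is odd. *)
  have bet : tau' ^+ k < 1 - al.
    by rewrite -[ltLHS]mul1r -ltr_pdivlMr //; lra.
  have [k4|k4] := leqP 4 k.
    have k4R : (4 : R) <= k%:R by rewrite ler_nat.
    apply: (pow_lt k) => //.
    apply: (lt_le_trans bet); rewrite -(ler_pM2r sS) l2 ler_pM2l ?exprn_gt0 //.
    have h1 : 4 * w <= k%:R * w by rewrite ler_pM2r.
    have h2 : 3 * x <= s%:R * x by rewrite ler_pM2r.
    by apply: sin_leD; lra.
  have [k3|k3] : (k = 3 \/ k = 2)%N by clear -k1 k4; lia.
    by move: c1; rewrite k3 cos_3pi; lra.
  have s3 := ks k3; subst k s.
  (* From [3 x + 2 w = 2 pi], all angles are given by [y]: [x = 2 y], [w = pi - 3 y],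
     [x + w = pi - y]. *)
  pose y := x / 2; pose c := cos y.
  have sy : 0 < sin y by apply: sin_gt0_pi; apply/andP; split; rewrite /y; lra.
  have c0 : 0 < c by apply: cos_gt0_pihalf; apply/andP; split; rewrite /y; lra.
  have clt : c < 1 by apply: cos_lt1; apply/andP; split; rewrite /y; lra.
  have e1 : sin x = 2 * sin y * c.
    have -> : x = y *+ 2 by rewrite mulr2n /y; lra.
    by rewrite sin_mulr2n mulr2n -/c; ring.
  have e2 : sin (x + w) = sin y.
    have -> : x + w = pi - y by rewrite /y; lra.
    by rewrite sinB cospi sinpi; lra.
  have e3 : sin w = sin y * (4 * c ^+ 2 - 1).
    have -> : w = pi - (y + y *+ 2) by rewrite mulr2n /y; lra.
    rewrite sinB cospi sinpi sinD sin_mulr2n cos_mulr2n -/c !mulr2n; ring.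
  have ea : al = 2 * c * tau ^+ 3.
    by apply: (mulIf (lt0r_neq0 sy)); rewrite -[in LHS]e2 l1 e1; ring.
  have eb : 1 - al = (4 * c ^+ 2 - 1) * tau ^+ 2.
    by apply: (mulIf (lt0r_neq0 sy)); rewrite -[in LHS]e2 l2 e3; ring.
  (* The sum of [ea] and [eb] is a cubic in [tau] that splits into this factor and a positive
     one. *)
  have g1 : 2 * c * tau = 1.
    have h : 0 < 2 * c * tau + 1 + tau ^+ 2 by rewrite !addr_gt0 ?mulr_gt0 ?exprn_gt0.
    have : (2 * c * tau - 1) * (2 * c * tau + 1 + tau ^+ 2) = 0.
      transitivity ((4 * c ^+ 2 - 1) * tau ^+ 2 - (1 - 2 * c * tau ^+ 3)); first by ring.
      by rewrite -eb -ea subrr.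
    by move/eqP; rewrite mulf_eq0 (gt_eqF h) orbF subr_eq0 => /eqP.
  have ea2 : al = tau ^+ 2.
    transitivity ((2 * c * tau) * tau ^+ 2); first by rewrite ea; ring.
    by rewrite g1 mul1r.
  (* Thus [al = tau ^ 2 > 1 / 4], while the collapsed triangle gives
     [al = tau' (1 - tau') <= 1 / 4]: this case cannot occur. *)
  have thalf : 1 < 2 * tau by rewrite -g1; nra.
  have re2 : (1 - al) * tau' - al = tau' ^+ 3.
    have t'n : tau' != 0 by rewrite gt_eqF.
    have -> : (1 - al) * tau' - al = (- (al / tau' ^+ 3) + (1 - al) / tau' ^+ 2) * tau' ^+ 3.
      by field.
    by rewrite re mul1r.
  have ea3 : al = tau' * (1 - tau').
    have h : 1 + tau' != 0 by rewrite gt_eqF // addr_gt0.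
    apply: (mulIf h); transitivity (tau' - tau' ^+ 3); last by ring.
    by rewrite -re2; ring.
  have h1 := sqr_ge0 (2 * tau' - 1).
  by nra.
- rewrite ex' ew' cos0 cospi !mulrN1 !mulr1 mulr0 addr0 in re c1.
  (* The other collapsed triangle, with phase [s pi]: [s = 3] is odd, and [s >= 4] gives
     [al <= tau ^ s]. *)
  have alt : tau' ^+ s < al.
    by rewrite -[ltLHS]mul1r -ltr_pdivlMr //; lra.
  have [s4|s4] := leqP 4 s; last first.
    have s3 : (s = 3)%N by clear -s2 s4; lia.
    by move: c1; rewrite s3 cos_3pi; lra.
  have s4R : (4 : R) <= s%:R by rewrite ler_nat.
  apply: (pow_lt s) => //.
  apply: (lt_le_trans alt); rewrite -(ler_pM2r sS) l1 ler_pM2l ?exprn_gt0 //.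
  have h1 : 2 * w <= k%:R * w by rewrite ler_pM2r.
  have h2 : 4 * x <= s%:R * x by rewrite ler_pM2r.
  by rewrite addrC; apply: sin_leD; lra.
- by move: re; rewrite ex' ew' cospi; lra.
Qed.

(** * Moduli of the roots and points of the boundary *)

Lemma nat_root (R : realType) (d : nat) (rho : R) : (0 < d)%N -> 0 < rho ->
  exists2 tau : R, 0 < tau & tau ^+ d = rho.
Proof.
move=> d0 rho0; exists (rho `^ d%:R^-1); first exact: powR_gt0.
rewrite -powR_mulrn ?powR_ge0 // -powRrM mulVf ?powRr1 ?(ltW rho0) //.
by rewrite pnatr_eq0 -lt0n.
Qed.

Lemma phi_conj (R : realType) (n q s : nat) (al : R) (z : R[i]) :
  phi n q s al z^* = (phi n q s al z)^*.
Proof.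
pose cj : {rmorphism R[i] -> R[i]} := conjc.
have cjR (a : R) : cj a%:C = a%:C := conjc_real a.
change (phi n q s al (cj z) = cj (phi n q s al z)).
by rewrite /phi (rmorphB cj) (rmorphXn cj) (rmorphB cj)
  (rmorphXn cj) (rmorphM cj) !cjR (fmorphXz cj).
Qed.

(* If the phase condition held with a larger second angle than [coangle], the
   same ray would carry a root of larger modulus, and the point would be
   interior. *)
Lemma boundary_root_triangle (R : realType) (n p q r s : nat) (x tau al : R) :
  (1 < q)%N -> (q < s)%N -> (s <= n)%N ->
  (r * q = p * s + 1)%N -> (n < q + s)%N ->
  let d := (n %/ q)%N in
  let z := (tau ^+ d)%:C * cis ((x + 2 * pi * p%:R) / q%:R) in
  0 < x -> s%:R * x < 2 * pi -> 0 < tau -> 0 < al -> al <= 1 ->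
  boundary (@Theta R n) z ->
  (1 - (1 - al)%:C / z ^+ q) ^+ d * z ^+ s = (al ^+ d)%:C ->
  al * sin (x + coangle s (q * d) x) = tau ^+ s * sin x /\
  (1 - al) * sin (x + coangle s (q * d) x) = tau ^+ (q * d) * sin (coangle s (q * d) x).
Proof.
move=> q1 qs sn det nqs d z x0 xs tau0 al0 al1 bd root.
have d0 : (0 < d)%N by rewrite divn_gt0 ?(leq_trans (ltnW qs) sn) // ltnW.
have s2 : (2 < s)%N by clear -q1 qs; lia.
have s0 : (0 < s)%N by apply: ltn_trans s2.
have qd1 : (1 < q * d)%N by clear -q1 d0; nia.
have [w0 wpi] := coangle_bounds s2 qd1 x0 xs.
have ew := coangleE s x (ltnW qd1).
have q0 : (q%:R : R) != 0 by rewrite pnatr_eq0 -lt0n ltnW.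
have qp : 0 < q%:R :> R by rewrite ltr0n ltnW.
have xpi : 0 <= x <= pi by apply/andP; split; lra.
have uq : cis ((x + 2 * pi * p%:R) / q%:R) ^+ q = cis x.
  rewrite cisMn.
  have -> : q%:R * ((x + 2 * pi * p%:R) / q%:R) = x + 2 * pi * p%:R by field.
  by rewrite cisD cis_2pi_nat mulr1.
have [w [wr re im ph]] := triangle_of_root d0 al0 al1 tau0 xpi (norm_cis _) uq root.
have be0 : 0 <= 1 - al by rewrite subr_ge0.
have T0 i : 0 < tau ^+ i by rewrite exprn_gt0.
have l1 := law_of_sines_left (T0 s) re im.
have l2 := law_of_sines_right (T0 (d * q)%N) re im.
have tau1 : tau <= 1.
  apply: (triangle_scale_le1 al0 al1 tau0 s0).
  exact: (triangle_inequality (ltW al0) be0 (T0 s) (T0 (d * q)%N) re).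
have sx : 0 < sin x by apply: sin_gt0_pi; apply/andP; split; lra.
(* This is [(s x + q d w - 2 pi) / q], a multiple of [2 pi] by the determinant identity. It exceeds
   [- 2 pi], so it is zero or positive; zero means that [w] is the coangle. *)
pose y := d%:R * w + (s%:R * x - 2 * pi) / q%:R.
have hdet : r%:R * q%:R = p%:R * s%:R + 1 :> R by rewrite -!natrM det natrD.
have cy : cos y = 1.
  have : cis y = 1.
    rewrite -ph -[LHS]mulr1 -(cis_2pi_nat R r) -cisD !cisMn -cisD.
    congr (cis _); rewrite /y; apply: (mulIf q0).
    transitivity (q%:R * d%:R * w + s%:R * x - 2 * pi + 2 * pi * (r%:R * q%:R)).
      by field.
    by rewrite hdet; field.
  by move/(congr1 (@complex.Re R)).
have [wge wle] : 0 <= w /\ w <= pi by apply/andP.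
have dw : 0 <= d%:R * w by rewrite mulr_ge0.
have ylow : - (2 * pi) < y.
  have : - (2 * pi) < (s%:R * x - 2 * pi) / q%:R.
    rewrite ltr_pdivlMr //.
    have : 0 < s%:R * x by rewrite mulr_gt0 // ltr0n.
    have : 1 <= q%:R :> R by rewrite ler1n ltnW.
    by have := pi_gt0 R; nra.
  by rewrite /y; lra.
have y0 := cos_eq1_gtN2pi ylow cy.
have d0R : 0 < d%:R :> R by rewrite ltr0n.
have ewy : w = coangle s (q * d) x + y / d%:R.
  rewrite /coangle /y natrM; field.
  by rewrite q0 gt_eqF.
have [y00|yn0] := eqVneq y 0.
  by move: ewy; rewrite y00 mul0r addr0 => <-; rewrite mulnC.
have ltw : coangle s (q * d) x < w.
  by rewrite ewy ltrDl divr_gt0 // lt_neqAle eq_sym yn0.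
exfalso; apply: (arc_interior q1 qs sn det nqs x0 xs tau0 _ bd).
have sS : 0 < sin (x + w) by rewrite -(pmulr_rgt0 _ al0) l1 mulr_gt0.
have xw : x + w < pi.
  by apply: lt_pi_of_sin_gt0 => //; lra.
apply: (sine_defect_lt0 sx w0 ltw).
- by lra.
- exact: ltW.
- by rewrite exprn_ile1 // ltW.
by rewrite mulrC -l1 [_ * tau ^+ _]mulrC -l2; ring.
Qed.

(** The root [z] has a triangle of its own, whose first angle is the argument of [z ^ q]; the sign
    condition puts it in [[0, pi]], and [triangle_scale_max] compares the scales. *)
Lemma root_norm_le (R : realType) (n p q r s : nat) (x w al tau : R) (z : R[i]) :
  (1 < q)%N -> (q < s)%N -> (s <= n)%N -> (r * q = p * s + 1)%N ->
  let d := (n %/ q)%N in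
  0 < al < 1 -> 0 < x -> 0 < w -> x + w < pi ->
  s%:R * x + (q * d)%:R * w = 2 * pi -> 0 < tau ->
  al * sin (x + w) = tau ^+ s * sin x ->
  (1 - al) * sin (x + w) = tau ^+ (q * d) * sin w ->
  phi n q s al z = 0 -> z != 1 -> 0 <= complex.Im (z ^+ q) ->
  `|z| <= (tau ^+ d)%:C.
Proof.
move=> q1 qs sn det d al01 x0 w0 xw ef tau0 l1 l2 root z1 imz.
have [al0 al1] : 0 < al /\ al < 1 by apply/andP.
have d0 : (0 < d)%N by rewrite divn_gt0 ?(leq_trans (ltnW qs) sn) // ltnW.
have s2 : (2 < s)%N by clear -q1 qs; lia.
have qd1 : (1 < q * d)%N by clear -q1 d0; nia.
(* Here [q = 2] and [d = 1], so [n < 4] and [2 < s <= n]. *)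
have qd2 : (q * d = 2 -> s = 3)%N.
  have : (n < d.+1 * q)%N by rewrite ltn_ceil // ltnW.
  by clear -q1 qs sn d0; nia.
have [->|zn0] := eqVneq z 0; first by rewrite normr0 ler0c exprn_ge0 // ltW.
have [tau' tau'0 ez] : exists2 tau' : R, 0 < tau' & `|z| = (tau' ^+ d)%:C.
  have : 0 < `|z| by rewrite normr_gt0.
  rewrite normc_def ltcR => h.
  by have [tau' tau'0 e] := nat_root d0 h; exists tau' => //; rewrite e.
have tn : (tau' ^+ d)%:C != 0 :> R[i] by rewrite -ez normr_eq0.
pose u := z / (tau' ^+ d)%:C.
have zu : z = (tau' ^+ d)%:C * u by rewrite mulrC divfK.
have nu : `|u| = 1 by rewrite normrM normfV -ez normr_id divff // normr_eq0.
have [x' x'pi uq] : exists2 x' : R, 0 <= x' <= pi & u ^+ q = cis x'.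
  have [|rr [x' [rr0 x'pi e]]] := @polar_upper R (u ^+ q).
    have -> : u ^+ q = ((tau' ^+ d) ^- q)%:C * z ^+ q.
      by rewrite /u expr_div_n mulrC -rmorphXn -fmorphV.
    case: (z ^+ q) imz => a b /= b0.
    by rewrite mul0r addr0 mulr_ge0 // invr_ge0 !exprn_ge0 // ltW.
  exists x' => //; have := congr1 Num.norm e.
  rewrite normrX nu expr1n normrM norm_cis mulr1 norm_real_complex // => e1.
  by rewrite e -e1 mul1r.
have eq_root := phi_rootE zn0 root; rewrite -/d zu in eq_root.
have [w' [w'pi re im ph]] := triangle_of_root d0 al0 (ltW al1) tau'0 x'pi nu uq eq_root.
rewrite ez lecR; apply: lerXn2r; rewrite ?nnegrE ?(ltW tau0) ?(ltW tau'0) //.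
rewrite mulnC in re im.
apply: (triangle_scale_max s2 qd1 qd2 al01 x0 w0 xw ef tau0 l1 l2 x'pi w'pi tau'0 re im).
  have : cis (s%:R * x' + (q * d)%:R * w') = 1.
    rewrite cisD -!cisMn -uq mulnC exprM -exprM mulnC exprM -exprMn.
    by rewrite mulrC ph expr1n.
  by move/(congr1 (@complex.Re R)).
(* Zero angles give [u ^ q = u ^ s = 1], so [u = u ^ (p s + 1) = u ^ (r q) = 1]; then [re] forces
   [tau' = 1], and [z] would be 1. *)
move=> [ex' ew']; apply/negP: z1; rewrite negbK.
rewrite ex' ew' !cos0 !mulr1 in re; rewrite ex' cis0 in uq; rewrite ew' cis0 expr1n mul1r in ph.
have u1 : u = 1.
  by rewrite -[u]mul1r -[X in X * _](expr1n _ p) -ph -exprM -exprSr mulnC -addn1 -det mulnC exprM uq expr1n.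
have s0 : (0 < s)%N by apply: ltn_trans s2.
have tau1 : tau' <= 1.
  by apply: (@triangle_scale_le1 _ al tau' s (q * d) al0 (ltW al1) tau'0 s0); rewrite re.
have tau1' : tau' = 1.
  apply/eqP; rewrite eq_le tau1 /= leNgt; apply/negP => lt1.
  have h1 : al < al / tau' ^+ s.
    by rewrite ltr_pdivlMr ?exprn_gt0 // gtr_pMr // exprn_ilt1 // ?(ltW tau'0) // -lt0n.
  have h2 : 1 - al <= (1 - al) / tau' ^+ (q * d).
    by rewrite ler_pdivlMr ?exprn_gt0 // ger_pMr ?subr_gt0 // exprn_ile1 // ltW.
  by have := ltr_leD h1 h2; rewrite re addrC subrK ltxx.
by rewrite zu u1 tau1' expr1n mulr1.
Qed.

Lemma subdominant_arc (R : realType) (n p q r s : nat) (th rho al : R) :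
  (1 < q)%N -> (q < s)%N -> (s <= n)%N ->
  (r * q = p * s + 1)%N -> (n < q + s)%N ->
  2 * pi * p%:R / q%:R < th < 2 * pi * r%:R / s%:R -> 0 < rho ->
  boundary (@Theta R n) (rho%:C * cis th) -> 0 <= al <= 1 ->
  phi n q s al (rho%:C * cis th) = 0 ->
  subdominant_root n q s al (rho%:C * cis th).
Proof.
move=> q1 qs sn det nqs /andP[th1 th2] rho0 bd /andP[al0 al1] root.
pose d := (n %/ q)%N.
have d0 : (0 < d)%N by rewrite divn_gt0 ?(leq_trans (ltnW qs) sn) // ltnW.
have s2 : (2 < s)%N by clear -q1 qs; lia.
have qd1 : (1 < q * d)%N by clear -q1 d0; nia.
have qp : 0 < q%:R :> R by rewrite ltr0n ltnW.
have sp : 0 < s%:R :> R by rewrite ltr0n ltnW // ltnW.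
have hdet : r%:R * q%:R = p%:R * s%:R + 1 :> R by rewrite -!natrM det natrD.
(* The argument of the [q]-th power after removal of [p] turns; the determinant identity places it
   below [2 pi / s]. *)
pose x := q%:R * th - 2 * pi * p%:R.
have x0 : 0 < x by rewrite subr_gt0 [q%:R * _]mulrC -ltr_pdivrMr.
have xs : s%:R * x < 2 * pi.
  have : th * s%:R * q%:R < 2 * pi * (r%:R * q%:R).
    by rewrite mulrA ltr_pM2r // -ltr_pdivlMr.
  by rewrite hdet /x; lra.
have [tau tau0 etau] := nat_root d0 rho0.
have eth : th = (x + 2 * pi * p%:R) / q%:R by rewrite /x; field; rewrite gt_eqF.
have s3R : (3 : R) <= s%:R by rewrite ler_nat.
have sx : 0 < sin x by apply: sin_gt0_pi; apply/andP; split; nra.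
have zq : (rho%:C * cis th) ^+ q = (rho ^+ q)%:C * cis x.
  rewrite exprMn -rmorphXn cisMn; congr (_ * _).
  have -> : q%:R * th = x + 2 * pi * p%:R by rewrite /x; ring.
  by rewrite cisD cis_2pi_nat mulr1.
have zqn1 : (rho%:C * cis th) ^+ q != 1.
  apply/eqP; rewrite zq => /(congr1 (@complex.Im R)) /=.
  by move/eqP; rewrite mul0r addr0 mulf_eq0 !gt_eqF // exprn_gt0.
have zn0 : rho%:C * cis th != 0.
  by rewrite mulf_neq0 ?cis_neq0 // (inj_eq (@complexI R)) gt_eqF.
have rootE := phi_rootE zn0 root.
(* At [al = 0] a nonzero root has [q]-th power 1, which [zqn1] excludes. *)
have alp : 0 < al.
  rewrite lt_neqAle al0 andbT; apply/eqP => e.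
  move: rootE; rewrite -e subr0 expr0n -/d (gtn_eqF d0) /= => /eqP.
  rewrite mulf_eq0 !expf_eq0 (negPf zn0) andbF orbF d0 /= subr_eq0 => /eqP h.
  have := congr1 (fun c => c * (rho%:C * cis th) ^+ q) h.
  rewrite mul1r divfK ?expf_neq0 // => e1.
  by move: zqn1; rewrite e1 eqxx.
have [w0 wpi] := coangle_bounds s2 qd1 x0 xs.
have ew := coangleE s x (ltnW qd1).
have [] := @boundary_root_triangle R n p q r s x tau al q1 qs sn det nqs x0 xs tau0 alp al1.
- by rewrite -/d etau -eth.
- by rewrite -/d etau -eth.
rewrite -/d => l1 l2.
have sw : 0 < sin (coangle s (q * d) x) by apply: sin_gt0_pi; apply/andP; split; lra.
have sS : 0 < sin (x + coangle s (q * d) x) by apply: sin_gt0_pi; apply/andP; split; lra.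
have alt1 : al < 1.
  by rewrite -subr_gt0 -(pmulr_lgt0 _ sS) l2 mulr_gt0 // exprn_gt0.
have al01 : 0 < al < 1 by rewrite alp.
have bound := root_norm_le q1 qs sn det al01 x0 w0 wpi ew tau0 l1 l2.
split => //; split.
  by apply/eqP => e; move: zqn1; rewrite e expr1n eqxx.
move=> z rz z1.
have -> : `|rho%:C * cis th| = (tau ^+ d)%:C.
  by rewrite normrM norm_cis mulr1 etau norm_real_complex // ltW.
have [im|im] := lerP 0 (complex.Im (z ^+ q)); first exact: bound.
(* [phi] has real coefficients, so the conjugate is a root of equal modulus in the case already
   treated. *)
rewrite -normcJ; apply: bound.
- by rewrite phi_conj rz conjc0.
- by rewrite -(inj_eq (can_inj (@conjcK R))) conjcK conjc1.
- rewrite -(rmorphXn (conjc : {rmorphism R[i] -> R[i]})).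
  by case: (z ^+ q) im => a b /= /ltW; rewrite oppr_ge0.
Qed.

Unset Implicit Arguments.

Theorem theorem5p5 (R : realType) (n p q r s : nat) (th rho alpha : R)
  (t : R[i]) :
  Farey_pair n p q r s ->
  (0 < p%:Q / q%:Q)%R -> (r%:Q / s%:Q < 1)%R -> (q < s)%N ->
  in_arg p q r s th ->
  0 < rho -> t = Complex (rho * cos th) (rho * sin th) ->
  boundary (@Theta R n) t ->
  0 <= alpha <= 1 -> phi n q s alpha t = 0 ->
  subdominant_root n q s alpha t.
Proof.
move=> Fp p0 _ qs arg rho0 et bd al root.
have [[/andP[pq qn] _] [[/andP[rs sn] _] _]] := Fp.
have p1 : (0 < p)%N by rewrite lt0n; apply: contraTneq p0 => ->; rewrite mul0r ltxx.
have q1 : (1 < q)%N by clear -p1 pq; lia.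
have [det nqs] := Farey_pair_det Fp p1 qs.
have {et}et : t = rho%:C * cis th.
  by rewrite et; apply/eqP; rewrite eq_complex /= !mul0r subr0 addr0 !eqxx.
case: arg => arg; first by rewrite et in bd root *; exact: (subdominant_arc q1 qs sn det nqs arg).
(* The second arc is the mirror image of the first; conjugation preserves [Theta], its boundary and
   the roots. *)
have et' : t^* = rho%:C * cis (2 * pi - th).
  transitivity ((rho%:C)^* * (cis th)^*).
    by rewrite et; exact: (rmorphM (conjc : {rmorphism R[i] -> R[i]})).
  transitivity (rho%:C * cis (- th)).
    by congr (_ * _); [exact: conjc_real | exact: conj_cis].
  rewrite cisD.
  by have := @cis_2pi_nat R 1; rewrite mulr1 => ->; rewrite mul1r.
have [|||||_ [t1 tmax]] := @subdominant_arc R n p q r s (2 * pi - th) rho alpha q1 qs sn det nqs.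
- move: arg; rewrite !natrB ?(ltnW rs) ?(ltnW pq) //.
  have -> : 2 * pi * (s%:R - r%:R) / s%:R = 2 * pi - 2 * pi * r%:R / s%:R :> R.
    by field; rewrite pnatr_eq0; clear -rs; lia.
  have -> : 2 * pi * (q%:R - p%:R) / q%:R = 2 * pi - 2 * pi * p%:R / q%:R :> R.
    by field; rewrite pnatr_eq0; clear -pq; lia.
  by move=> /andP[h1 h2]; apply/andP; split; lra.
- exact: rho0.
- by rewrite -et'; exact: boundary_Theta_conj.
- exact: al.
- by rewrite -et' phi_conj root conjc0.
rewrite -et' in t1 tmax; split => //; split.
  by apply: contraNneq t1 => ->; rewrite conjc1.
by move=> w rw w1; rewrite -[`|t|]normcJ; exact: tmax.
Qed.
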